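(* Let $K=\{z:|\operatorname{Re}z|+|\operatorname{Im}z|\le1\}$, and define $$K_1=\{z\in K:|z-\tfrac{-1-i}{2}|\le\tfrac1{\sqrt2},\ |z-\tfrac{-1+i}{2}|\le\tfrac1{\sqrt2}\},$$ $$K_2=\{z\in K:|z-\tfrac{-1-i}{2}|\ge\tfrac1{\sqrt2},\ 0\le\operatorname{Im}z\le-\operatorname{Re}z\},$$ $$K_3=\{z\in K:|z-\tfrac{1+i}{2}|\ge\tfrac1{\sqrt2},\ -\operatorname{Im}z\le\operatorname{Re}z\le0\},$$ $$K_j=-i\,K_{j-3}\quad\text{for }j=4,\dots,12.$$ Then the diamond algorithm (whose fundamental set is $K$) satisfies the finite building property with $\mathcal{P}=\{K_1,\dots,K_{12}\}$.
   Context: Here $i=\sqrt{-1}$ and $\arg z\in(-\pi,\pi]$. Define $t:\mathbb{C}\to\mathbb{C}$ by $t(0)=0$; $t(z)=z-1$ if $-\pi/4\le\arg z<\pi/4$; $t(z)=z-i$ if $\pi/4\le\arg z<3\pi/4$; $t(z)=z+1$ if $\arg z\ge3\pi/4$ or $\arg z<-3\pi/4$; $t(z)=z+i$ if $-3\pi/4\le\arg z<-\pi/4$. The diamond algorithm is the choice function given by $\lfloor z\rceil=0$ if $z\in K$, and $\lfloor z\rceil=z-t^{n(z)}(z)$ if $z\notin K$, where $n(z)$ is the least positive integer with $t^{n(z)}(z)\in K$ and $K=\{z:|\operatorname{Re}z|+|\operatorname{Im}z|\le1\}$. The Gauss map $G:K\to K$ is $G(z)=-1/z-\lfloor-1/z\rceil$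 for $z\neq0$, $G(0)=0$. A finite partition of $K$ is a finite collection of closed sets with boundaries of zero Lebesgue measure and pairwise disjoint interiors whose union is $K$. A set is buildable from a collection $\mathcal{C}$ of closed sets (with null boundaries) if it is equal, up to measure zero, to some union of elements of $\mathcal{C}$. The algorithm satisfies the finite building property with $\mathcal{P}=\{K_1,\dots,K_N\}$ if $N>1$, $\mathcal{P}$ is a finite partition of $K$, and each $G(K_j)$ is buildable from $\mathcal{P}$. *)

(* Defs.v *)
From HB Require Import structures.
From mathcomp Require Import all_boot all_order all_algebra.
From mathcomp Require Import all_classical all_reals all_analysis.
From mathcomp Require Import complex lra.
Import numFieldNormedType.Exports.
Import Order.TTheory GRing.Theory Num.Theory.

Set Implicit Arguments.
Unset Strict Implicit.
Unset Printing Implicit Defensive.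

Local Open Scope classical_set_scope.
Local Open Scope ring_scope.
Local Open Scope complex_scope.

(* [R[i]] carries no topology in the libraries; it gets the one induced by its
   modulus. *)
HB.instance Definition _ (R : rcfType) := NormedModule.copy R[i] R[i]^o.

Section Planar.
Variable R : realType.
Implicit Types (z : R[i]) (A : set R[i]).

(* Not ['i]: on the numClosedFieldType [R[i]] that notation may denote
   [Num.imaginary], an unspecified square root of -1. *)
Definition iC : R[i] := 0 +i* 1.

(* The principal argument in ]-pi, pi], see [cargP] (junk value pi / 2 at 0). *)
Definition carg z : R :=
  let a := acos (complex.Re z / complex.Re `|z|) in
  if 0 <= complex.Im z then a else - a.

Lemma cargP z (r := complex.Re `|z|) : z != 0 ->
  [/\ - pi < carg z, carg z <= pi,
      complex.Re z = r * cos (carg z) & complex.Im z = r * sin (carg z)].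
Proof.
move=> z0.
have rE : r = Num.sqrt (complex.Re z ^+ 2 + complex.Im z ^+ 2).
  by rewrite /r normc_def.
set x := complex.Re z in rE *; set y := complex.Im z in rE *.
have s0 : 0 < x ^+ 2 + y ^+ 2.
  rewrite lt_neqAle addr_ge0 ?sqr_ge0// andbT eq_sym.
  rewrite paddr_eq0 ?sqr_ge0// !sqrf_eq0; apply: contra z0 => /andP[/eqP x0 /eqP y0].
  by rewrite eq_complex /= -/x -/y x0 y0 !eqxx.
have r0 : 0 < r by rewrite rE sqrtr_gt0.
have r2 : r ^+ 2 = x ^+ 2 + y ^+ 2 by rewrite rE sqr_sqrtr// ltW.
have yr : `|y| = r * Num.sqrt (1 - (x / r) ^+ 2).
  have -> : 1 - (x / r) ^+ 2 = (y / r) ^+ 2.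
    rewrite !expr_div_n r2; apply: (mulIf (lt0r_neq0 s0)).
    by rewrite mulrBl mul1r !divfK ?lt0r_neq0//; lra.
  by rewrite sqrtr_sqr normrM normfV (gtr0_norm r0) mulrC divfK ?lt0r_neq0.
have xr : -1 <= x / r <= 1.
  rewrite -ler_norml -(@ler_pXn2r _ 2)// ?nnegrE// expr1n -normrX ger0_norm ?sqr_ge0//.
  by rewrite expr_div_n r2 ler_pdivrMr// mul1r lerDl sqr_ge0.
have cE : r * cos (acos (x / r)) = x.
  by rewrite acosK ?in_itv// mulrC divfK ?lt0r_neq0.
rewrite /carg -/r -/x -/y; case: ifPn => [y0|].
  split; last by rewrite sin_acos// -yr ger0_norm.
  - by apply: lt_le_trans (acos_ge0 xr); rewrite oppr_lt0 pi_gt0.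
  - exact: acos_lepi.
  - by rewrite cE.
rewrite -ltNge => y0; split.
- rewrite ltrN2 acos_ltpi//; move: xr => /andP[xr1 ->]; rewrite andbT.
  rewrite lt_neqAle xr1 andbT; apply/eqP => xE.
  by move: yr; rewrite -xE sqrrN expr1n subrr sqrtr0 mulr0 => /normr0_eq0 yE;
    rewrite yE ltxx in y0.
- by apply: le_trans (pi_ge0 R); rewrite oppr_le0 acos_ge0.
- by rewrite cosN cE.
- by rewrite sinN mulrN sin_acos// -yr ltr0_norm// opprK.
Qed.

Definition diamond_set : set R[i] :=
  [set z | `|complex.Re z| + `|complex.Im z| <= 1].

Definition diamond_step z : R[i] :=
  let a := carg z in
  if z == 0 then 0
  else if - (pi / 4) <= a < pi / 4 then z - 1
  else if pi / 4 <= a < 3 * pi / 4 then z - iC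
  else if (3 * pi / 4 <= a) || (a < - (3 * pi / 4)) then z + 1
  else z + iC.

Lemma diamond_stepP z (x := complex.Re z) (y := complex.Im z) : z != 0 ->
  [\/ diamond_step z = z - 1 /\ `|y| <= x,
      diamond_step z = z - iC /\ `|x| <= y,
      diamond_step z = z + 1 /\ `|y| <= - x
    | diamond_step z = z + iC /\ `|x| <= - y].
Proof.
move=> z0; have [a1 a2 xE yE] := cargP z0; move: a1 a2 xE yE.
rewrite -/x -/y /diamond_step (negbTE z0) !ler_norml.
set r := complex.Re `|z|; set a := carg z => a1 a2 xE yE.
have p0 : 0 < pi :> R := pi_gt0 R.
have r0 : 0 <= r by rewrite /r normc_def /= sqrtr_ge0.
set c : R := cos (pi / 4).
have c0 : 0 < c by apply: cos_gt0_pihalf; lra.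
have sE : sin (pi / 4) = c :> R.
  by rewrite /c -[in RHS]cosN -cosBpihalf; congr (cos _); lra.
have eD : c * (x + y) = r * cos (a - pi / 4).
  by rewrite xE yE cosB sE -/c; lra.
have eB : c * (x - y) = r * cos (a + pi / 4).
  by rewrite xE yE cosD sE -/c; lra.
have cpos b : - (pi / 2) <= b <= pi / 2 -> 0 <= r * cos b.
  by move=> ?; rewrite mulr_ge0// cos_ge0_pihalf.
have cneg b : pi / 2 <= b <= 3 * pi / 2 -> r * cos b <= 0.
  move=> hb; rewrite -[b](subrK pi) cosDpi mulrN oppr_le0.
  by apply: cpos; lra.
have cneg' b : - (3 * pi / 2) <= b <= - (pi / 2) -> r * cos b <= 0.
  by move=> ?; rewrite -cosN; apply: cneg; lra.
have posE (u : R) : 0 <= c * u -> 0 <= u by rewrite pmulr_rge0.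
have negE (u : R) : c * u <= 0 -> u <= 0 by rewrite pmulr_rle0.
have [h1|h1] := ltP a (- (3 * pi / 4)).
  have -> : (- (pi / 4) <= a < pi / 4) = false by lra.
  have -> : (pi / 4 <= a < 3 * pi / 4) = false by lra.
  rewrite orbT; apply: Or43; split=> //.
  have : x + y <= 0 by apply: negE; rewrite eD; apply: cneg'; lra.
  have : x - y <= 0 by apply: negE; rewrite eB; apply: cneg'; lra.
  by lra.
have [h2|h2] := ltP a (- (pi / 4)).
  have -> : (pi / 4 <= a < 3 * pi / 4) = false by lra.
  have -> : (3 * pi / 4 <= a) = false by lra.
  apply: Or44; split=> //.
  have : x + y <= 0 by apply: negE; rewrite eD; apply: cneg'; lra.
  have : 0 <= x - y by apply: posE; rewrite eB; apply: cpos; lra.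
  by lra.
have [h3|h3] := ltP a (pi / 4).
  apply: Or41; split=> //.
  have : 0 <= x + y by apply: posE; rewrite eD; apply: cpos; lra.
  have : 0 <= x - y by apply: posE; rewrite eB; apply: cpos; lra.
  by lra.
have [h4|h4] := ltP a (3 * pi / 4).
  apply: Or42; split=> //.
  have : 0 <= x + y by apply: posE; rewrite eD; apply: cpos; lra.
  have : x - y <= 0 by apply: negE; rewrite eB; apply: cneg; lra.
  by lra.
apply: Or43; split=> //.
have : x + y <= 0 by apply: negE; rewrite eD; apply: cneg; lra.
have : x - y <= 0 by apply: negE; rewrite eB; apply: cneg; lra.
by lra.
Qed.

Let sum1 z := `|complex.Re z| + `|complex.Im z|.

Let diamond_step_sum1 z :
  sum1 (diamond_step z) <= 1 \/ sum1 (diamond_step z) <= sum1 z - 1.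
Proof.
have [->|z0] := eqVneq z 0.
  by left; rewrite /sum1 /diamond_step eqxx /= normr0 addr0 ler01.
rewrite /sum1; case: (diamond_stepP z0) => -[-> {z0}]; case: z => x y /= h.
all: rewrite ?subr0 ?addr0 ?oppr0 ?addr0.
all: move: h; case: (ger0P x) => ?; case: (ger0P y) => ? h.
all: try case: (ger0P (x - 1)) => ?.
all: try case: (ger0P (y - 1)) => ?.
all: try case: (ger0P (x + 1)) => ?.
all: try case: (ger0P (y + 1)) => ?.
all: by [left; lra | right; lra].
Qed.

(* The least exponent [n(z)] below is well defined. *)
Lemma diamond_step_returns z :
  exists n, (0 < n)%N && (iter n diamond_step z \in diamond_set).
Proof.
have : sum1 z <= (Num.trunc (sum1 z)).+1%:R by apply/ltW/truncnS_gt.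
move: (_.+1) => k; elim: k z => [|n IH] z zn.
all: have [?|h] := diamond_step_sum1 z; first by exists 1%N; rewrite inE.
  exists 1%N; rewrite inE /= /diamond_set/=; rewrite -/(sum1 _); lra.
have [m /andP[m0 hm]] : exists m, (0 < m)%N &&
    (iter m diamond_step (diamond_step z) \in diamond_set).
  by apply: IH; rewrite -natr1 in zn; lra.
by exists m.+1; rewrite iterSr.
Qed.

Definition diamond z : R[i] :=
  if z \in diamond_set then 0
  else z - iter (ex_minn (diamond_step_returns z)) diamond_step z.

(* The fundamental set of a choice function is the closure of {z - [z]}. *)
Lemma diamond_fundamental_set :
  closure [set z - diamond z | z in setT] = diamond_set.
Proof.
have -> : [set z - diamond z | z in setT] = diamond_set.
  apply/seteqP; split => [_ [z _ <-]|z zK].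
    rewrite /diamond; case: ifPn => [|_]; first by rewrite subr0 inE.
    rewrite opprB addrCA subrr addr0.
    by case: ex_minnP => n /andP[_]; rewrite inE.
  by exists z => //; rewrite /diamond mem_set// subr0.
apply/esym/closure_id; rewrite closedE => p pK; rewrite /diamond_set /= leNgt.
apply/negP; rewrite -/(sum1 p) => p1; set e := (sum1 p - 1) / 2.
have e0 : 0 < e by rewrite /e; lra.
apply: pK; exists e%:C; first by rewrite /= ltcR.
move=> z /= pz zK.
have abs_le (w : R[i]) : `|complex.Re w| <= complex.Re `|w| /\
    `|complex.Im w| <= complex.Re `|w|.
  by rewrite normc_def /= -!sqrtr_sqr !ler_wsqrtr// ?lerDl ?lerDr ?sqr_ge0.
have [xpz ypz] := abs_le (p - z).
move: pz; rewrite ltcE /= => /andP[_ pz].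
have : sum1 p <= sum1 z + (`|complex.Re (p - z)| + `|complex.Im (p - z)|).
  have tri (u v : R) : `|u| <= `|v| + `|u - v|.
    by rewrite -{1}(subrK v u) addrC ler_normD.
  rewrite /sum1; case: (p) (z) => px py [zx zy] /=.
  by move: (tri px zx) (tri py zy); lra.
move: zK; rewrite /diamond_set/= -/(sum1 z) => zK psum.
have {}pz : complex.Re `|p - z| < e by [].
by rewrite /e in pz; lra.
Qed.

Definition null_set A :=
  (lebesgue_measure \x lebesgue_measure)%E.-negligible
    [set p : R * R | A (p.1 +i* p.2)].

Definition boundary A := closure A `\` A°.

Definition finite_partition A (N : nat) (P : 'I_N -> set R[i]) :=
  [/\ forall j, closed (P j) /\ null_set (boundary (P j)),
      forall j k, j != k -> (P j)° `&` (P k)° = set0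
    & \bigcup_j P j = A].

Definition buildable (N : nat) (P : 'I_N -> set R[i]) A :=
  exists J : {set 'I_N}, null_set (A `+` \bigcup_(j in [set` J]) P j).

Definition gauss_map (f : R[i] -> R[i]) z : R[i] :=
  if z == 0 then 0 else -1 / z - f (-1 / z).

(* [f] is the choice function of the algorithm and [A] its fundamental set. *)
Definition finite_building (f : R[i] -> R[i]) A
    (N : nat) (P : 'I_N -> set R[i]) :=
  [/\ (1 < N)%N, finite_partition A P
    & forall j, buildable P (gauss_map f @` P j)].

(* Numbered from 0: [diamond_cell j] is K_{j+1}. *)
Fixpoint diamond_cell (j : nat) : set R[i] :=
  match j with
  | 0 => [set z | [/\ diamond_set z,
        `|z - (-1 - iC) / 2| <= (1 / Num.sqrt 2)%:C
      & `|z - (-1 + iC) / 2| <= (1 / Num.sqrt 2)%:C]]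
  | 1 => [set z | [/\ diamond_set z,
        (1 / Num.sqrt 2)%:C <= `|z - (-1 - iC) / 2|
      & 0 <= complex.Im z <= - complex.Re z]]
  | 2 => [set z | [/\ diamond_set z,
        (1 / Num.sqrt 2)%:C <= `|z - (1 + iC) / 2|
      & - complex.Im z <= complex.Re z <= 0]]
  | k.+3 => [set - iC * z | z in diamond_cell k]
  end.

End Planar.

(* Main.v *)
(* The map [z |-> -1 / z] turns the lines and circles bounding the cells into
   lines and circles, so [w = -1 / z] ranges over a region cut out by such
   curves: a cone for [K_1], a diagonal strip minus a disc for [K_2] and [K_3].
   Subtracting units brings [w] back to [K] inside an invariant set, which bounds
   the image; conversely every point of the bound off the diagonals and the
   boundary of [K] is reached in at most three explicit steps. Hence, up to measure
   zero, [G(K_1)] is [K] without its left quarter and [G(K_2) = G(K_3)] is the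
   half of [K] where [Re z + Im z >= 0]; the other cells follow by rotation. *)

Require Import Defs.
From mathcomp Require Import all_boot all_order all_algebra.
From mathcomp Require Import all_classical all_reals all_analysis.
From mathcomp Require Import measurable_realfun complex ring lra.
Import numFieldNormedType.Exports.
Import Order.TTheory GRing.Theory Num.Theory.

Set Implicit Arguments.
Unset Strict Implicit.
Unset Printing Implicit Defensive.

Local Open Scope classical_set_scope.
Local Open Scope ring_scope.
Local Open Scope complex_scope.

(** * Lines and circles *)

Section Walls.
Variable R : realType.
Implicit Types (z w p : R[i]) (A B : set R[i]).

(** The coefficients of [q |z|^2 + a Re z + b Im z + c]: lines and circles form one family, stable
    under [z |-> -1 / z], and integer coefficients let finite checks compute. *)
Definition wall : Type := int * int * int * int.
Implicit Types (g : wall) (l : seq wall).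

Definition ev g z : R :=
  let: (q, a, b, c) := g in
  q%:~R * (complex.Re z ^+ 2 + complex.Im z ^+ 2) +
  a%:~R * complex.Re z + b%:~R * complex.Im z + c%:~R.

(** With [b != 0] the equation at fixed [Re z] is a nonzero polynomial in [Im z] of degree at most
    two. *)
Definition slanted g : bool := let: (q, a, b, c) := g in b != 0.

Definition oppw g : wall := let: (q, a, b, c) := g in (- q, - a, - b, - c).

Lemma ev_oppw g z : ev (oppw g) z = - ev g z.
Proof. by case: g => [[[q a] b] c]; rewrite /ev /= !rmorphN; ring. Qed.

Definition region l : set R[i] := [set z | all (fun g => 0 <= ev g z) l].

Lemma near_Re_Im z (e : R) : 0 < e -> \forall w \near z,
  `|complex.Re z - complex.Re w| < e /\ `|complex.Im z - complex.Im w| < e.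
Proof.
move=> e0; exists e%:C; first by rewrite /= ltcR.
move=> w /=; rewrite ltcE normc_def /= => /andP[_ zw].
split; (apply: le_lt_trans zw); rewrite -sqrtr_sqr ler_wsqrtr//.
  by case: z w => ? ? [? ?] /=; rewrite lerDl sqr_ge0.
by case: z w => ? ? [? ?] /=; rewrite lerDr sqr_ge0.
Qed.

Lemma continuous_Re : continuous (@complex.Re R).
Proof.
move=> z; apply/(@cvgrPdist_lt _ _ _ _ (nbhs_filter z)) => e e0.
by apply: filterS (near_Re_Im z e0) => w [].
Qed.

Lemma continuous_Im : continuous (@complex.Im R).
Proof.
move=> z; apply/(@cvgrPdist_lt _ _ _ _ (nbhs_filter z)) => e e0.
by apply: filterS (near_Re_Im z e0) => w [].
Qed.

Lemma continuous_ev g : continuous (ev g).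
Proof.
case: g => [[[q a] b] c] z; have zF := nbhs_filter z.
have hx := @continuous_Re z; have hy := @continuous_Im z.
rewrite /ev; apply: cvgD; last exact: cvg_cst.
apply: cvgD; last by apply: cvgM; [exact: cvg_cst | exact: hy].
apply: cvgD; last by apply: cvgM; [exact: cvg_cst | exact: hx].
apply: cvgM; first exact: cvg_cst.
by apply: cvgD; [apply: (cvgM hx hx) | apply: (cvgM hy hy)].
Qed.

Lemma open_ev_gt0 g : open [set z | 0 < ev g z].
Proof.
exact: (open_comp (fun z _ => @continuous_ev g z) (@open_gt R 0)).
Qed.

Lemma closed_ev_ge0 g : closed [set z | 0 <= ev g z].
Proof.
exact: (closed_comp (fun z _ => @continuous_ev g z) (@closed_ge R 0)).
Qed.

Lemma closed_region l : closed (region l).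
Proof.
elim: l => [|g l IH].
  by rewrite (_ : region _ = setT); [exact: closedT | exact/seteqP].
rewrite (_ : region _ = [set z | 0 <= ev g z] `&` region l).
  by apply: closedI IH; exact: closed_ev_ge0.
by apply/seteqP; split=> z /= /andP.
Qed.

Lemma interior_region l z : all (fun g => 0 < ev g z) l -> (region l)° z.
Proof.
elim: l => [_|g l IH /= /andP[gz /IH lz]].
  by rewrite (_ : region _ = setT); [rewrite interiorT | exact/seteqP].
have : [set w | 0 < ev g w]° z by rewrite ((interior_id _).1 (@open_ev_gt0 g)).
rewrite /interior; apply: filterS2 lz => w lw gw.
by rewrite /region /= ltW.
Qed.

Definition on_walls l : set R[i] := [set z | has (fun g => ev g z == 0) l].

(** A closure point has every [ev g z] nonnegative; if none vanishes all are positive, which is an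
    open condition. *)
Lemma boundary_region l : boundary (region l) `<=` on_walls l.
Proof.
move=> z [/(closed_region (l := l)) lz]; apply: contra_notT.
move=> /hasPn h; apply: interior_region; apply/allP => g gl.
by rewrite lt0r h//= (allP lz).
Qed.

(* A non-vertical line or a circle meets each vertical line in at most two
   points. *)
Lemma null_wall g : slanted g -> Defs.null_set [set z | ev g z = 0].
Proof.
move=> gb; rewrite /Defs.null_set.
set A := [set _ | _].
have mA : measurable A.
  rewrite (_ : A = (fun p : R * R => ev g (p.1 +i* p.2)) @^-1` [set 0]).
    rewrite -[_ @^-1` _]setTI.
    have : measurable_fun setT (fun p : R * R => ev g (p.1 +i* p.2)).
      case: g {gb A} => [[[q a] b] c]; rewrite /ev /=.
      have m1 := @measurable_fst _ _ R R.
      have m2 := @measurable_snd _ _ R R.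
      apply: measurable_funD; last exact: measurable_cst.
      apply: measurable_funD; last by apply: measurable_funM.
      apply: measurable_funD; last by apply: measurable_funM.
      apply: measurable_funM; first exact: measurable_cst.
      by apply: measurable_funD; apply: measurable_funX.
    by apply.
  by [].
exists A; split => //; rewrite /product_measure1.
apply: integral0_eq => x _ /=; apply: countable_lebesgue_measure0.
have [->|/set0P[y1]] := eqVneq (xsection A x) set0; first exact: countable0.
case: g gb @A mA => [[[q a] b] c] b0 A _; rewrite /xsection /= inE => Ay1.
apply: finite_set_countable.
(* By Vieta a second root is [- b / q - y1]. For [q = 0] this term is just [- y1], and [b != 0]
   rules out a second root. *)
apply: (sub_finite_set _ (finite_set2 y1 (- (b%:~R / q%:~R) - y1))) => y /=.
rewrite inE => Ay; have [->|yy1] := eqVneq y y1; [by left|right].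
have {Ay Ay1} : (y - y1) * (q%:~R * (y + y1) + b%:~R) = 0.
  move: Ay Ay1; rewrite /A /= => h1 h2.
  by rewrite -(subrr (0 : R)) -{1}h1 -h2; ring.
move/eqP; rewrite mulf_eq0 subr_eq0 (negbTE yy1) /= => /eqP h.
have q0 : q%:~R != 0 :> R.
  apply: contra b0 => /eqP q0; move: h; rewrite q0 mul0r add0r => /eqP.
  by rewrite intr_eq0.
by apply: (mulfI q0); rewrite mulrBr mulrN mulrCA mulfV//; lra.
Qed.

Lemma null_on_walls l : all slanted l -> Defs.null_set (on_walls l).
Proof.
elim: l => [_|g l IH /= /andP[gb lb]].
  rewrite /Defs.null_set (_ : [set _ | _] = set0); first exact: negligible_set0.
  by apply/seteqP; split.
rewrite /Defs.null_set (_ : [set _ | _] =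
    [set p : R * R | ev g (p.1 +i* p.2) = 0] `|` [set p | on_walls l (p.1 +i* p.2)]).
  by apply: negligibleU; [exact: null_wall | exact: IH].
apply/seteqP; split => p /=; first by case/orP => [/eqP|]; [left|right].
by move=> h; apply/orP; case: h => [/eqP|]; [left|right].
Qed.

(** A slanted wall has at most two points on a vertical line, so it misses one of the heights [0],
    [e / 2], [e / 3] above a point of [A]. *)
Lemma open_avoid_wall g A : slanted g -> open A -> A !=set0 ->
  A `&` [set z | ev g z != 0] !=set0.
Proof.
move=> gb oA [z Az]; have [gz|] := eqVneq (ev g z) 0; last by exists z.
have : nbhs z A by apply: open_nbhs_nbhs.
(* The radius is a complex number; positivity makes its imaginary part zero. *)
case=> [[e ?]]; rewrite /= ltcE /= => /andP[/eqP -> e0] eA.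
have near_z t : `|t| < e -> A (complex.Re z +i* (complex.Im z + t)).
  move=> te; apply: eA; rewrite /ball_ /= normc_def ltcE /= eqxx /=.
  case: (z) => x y /=; rewrite subrr expr0n add0r opprD addNKr.
  by rewrite sqrtr_sqr normrN.
pose w t := complex.Re z +i* (complex.Im z + t).
have [h1|h1] := eqVneq (ev g (w (e / 2))) 0; last first.
  by exists (w (e / 2)); split => //; apply: near_z; rewrite gtr0_norm; lra.
have [h2|h2] := eqVneq (ev g (w (e / 3))) 0; last first.
  by exists (w (e / 3)); split => //; apply: near_z; rewrite gtr0_norm; lra.
case: g gb gz h1 h2 => [[[q a] b] c] /= b0.
case: (z) => x y /= h0 h1 h2; exfalso.
(* Subtracting the equation at height 0 and dividing by [t] leaves an equation affine in [t]; two
   heights give [q = 0], then [b = 0]. *)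
have k (t : R) : t != 0 -> q%:~R * (x ^+ 2 + (y + t) ^+ 2) + a%:~R * x +
      b%:~R * (y + t) + c%:~R = 0 ->
    q%:~R * (2 * y + t) + b%:~R = 0 :> R.
  move=> t0 h; apply: (mulfI t0); rewrite mulr0 -(subrr (0 : R)) -{1}h -h0; ring.
have n0 (n : R) : 0 < n -> e / n != 0.
  by move=> n0; rewrite mulf_neq0 ?invr_eq0 ?gt_eqF.
have {}h1 := k _ (n0 2 (ltr0n _ 2)) h1.
have {}h2 := k _ (n0 3 (ltr0n _ 3)) h2.
have /eqP : e * q%:~R = 0 by move: h1 h2; lra.
rewrite mulf_eq0 gt_eqF//= => /eqP q0; move: h1; rewrite q0 mul0r add0r => /eqP.
by rewrite intr_eq0 (negbTE b0).
Qed.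

End Walls.

(** * The twelve cells *)

(** Pullback along multiplication by [i]: on the walls of a region it multiplies the region by
    [-i]. *)
Definition rotw (g : wall) : wall := let: (q, a, b, c) := g in (q, b, - a, c).

(** Pullback along [w |-> -1 / w], multiplied by [|w|^2]. *)
Definition invw (g : wall) : wall := let: (q, a, b, c) := g in (c, - a, b, q).

(* The cones [|y| <= -x] and [|x| <= y], truncated by the diamond. *)
Definition left_cone : seq wall :=
  [:: (0, -1, -1, 0); (0, -1, 1, 0); (0, 1, -1, 1); (0, 1, 1, 1)].

Definition up_cone : seq wall :=
  [:: (0, -1, 1, 0); (0, 1, 1, 0); (0, -1, -1, 1); (0, 1, -1, 1)].

(* The last circle of [K_2] and of [K_3] is redundant: it is listed so that any
   two cells lie on opposite sides of a common wall. *)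
Fixpoint cell_walls (j : nat) : seq wall :=
  match j with
  | 0 => left_cone ++ [:: (-1, -1, -1, 0); (-1, -1, 1, 0)]
  | 1 => left_cone ++ [:: (1, 1, 1, 0); (-1, -1, 1, 0)]
  | 2 => up_cone ++ [:: (1, -1, -1, 0); (-1, -1, 1, 0)]
  | k.+3 => map rotw (cell_walls k)
  end.

Lemma slanted_cell_walls (j : 'I_12) : all slanted (cell_walls j).
Proof.
have /allP : all (fun i => all slanted (cell_walls i)) (iota 0 12) by [].
by apply; rewrite mem_iota ltn_ord.
Qed.

(** A finite computation over all pairs; opposite sides of a common wall will give disjoint
    interiors. *)
Lemma cell_walls_opposite (j k : 'I_12) : j != k ->
  has (fun g => oppw g \in cell_walls k) (cell_walls j).
Proof.
have : all (fun i => all (fun l => (i != l) ==>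
   has (fun g => oppw g \in cell_walls l) (cell_walls i)) (iota 0 12)) (iota 0 12).
  by [].
move=> /allP h jk; have ji : val j \in iota 0 12 by rewrite mem_iota ltn_ord.
have ki : val k \in iota 0 12 by rewrite mem_iota ltn_ord.
by have /allP/(_ _ ki)/implyP := h _ ji; apply.
Qed.

Section Cells.
Variable R : realType.
Implicit Types (z w p : R[i]) (A B : set R[i]) (g : wall).
Local Notation iC := (iC R).

Lemma mul_iC z : iC * z = - complex.Im z +i* complex.Re z.
Proof. by case: z => x y; rewrite /Defs.iC; simpc. Qed.

Lemma mul_iCK z : - iC * (iC * z) = z.
Proof. by case: z => x y; rewrite /Defs.iC; simpc. Qed.

Lemma mul_iCVK z : iC * (- iC * z) = z.
Proof. by case: z => x y; rewrite /Defs.iC; simpc. Qed.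

Lemma ev_rotw g z : ev (rotw g) z = ev g (iC * z).
Proof.
case: g => [[[q a] b] c]; rewrite mul_iC /ev /= rmorphN; ring.
Qed.

Lemma cellS k z : diamond_cell (k.+3) z <-> diamond_cell k (iC * z).
Proof.
split=> [[w wk <-]|zk]; first by rewrite mul_iCVK.
by exists (iC * z) => //; rewrite mul_iCK.
Qed.

Lemma disc_le z (a b : R) :
  (`|z - (a +i* b)| <= (1 / Num.sqrt 2)%:C) =
  ((complex.Re z - a) ^+ 2 + (complex.Im z - b) ^+ 2 <= 1 / 2).
Proof.
rewrite normc_def lecR !mul1r -sqrtrV ?ler0n// ler_sqrt ?invr_ge0 ?ler0n//.
by case: z.
Qed.

Lemma disc_ge z (a b : R) :
  ((1 / Num.sqrt 2)%:C <= `|z - (a +i* b)|) =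
  (1 / 2 <= (complex.Re z - a) ^+ 2 + (complex.Im z - b) ^+ 2).
Proof.
rewrite normc_def lecR !mul1r -sqrtrV ?ler0n// ler_sqrt ?addr_ge0 ?sqr_ge0//.
by case: z.
Qed.

Lemma half_complex (a b : R) : (a +i* b) / 2 = (a / 2) +i* (b / 2).
Proof.
have n2 : (2 : R[i]) != 0 by rewrite pnatr_eq0.
apply: (mulIf n2); rewrite divfK//.
have -> : 2 = (2 +i* 0 : R[i]) by apply/eqP; rewrite eq_complex /= addr0 !eqxx.
by simpc; congr (_ +i* _); field.
Qed.

Lemma diamond_setE z : diamond_set z <->
  [/\ complex.Re z + complex.Im z <= 1, complex.Re z - complex.Im z <= 1,
      - complex.Re z + complex.Im z <= 1 & - complex.Re z - complex.Im z <= 1].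
Proof.
rewrite /diamond_set /=; case: z => x y /=.
by split => [|[h1 h2 h3 h4]]; case: (ger0P x) => ?; case: (ger0P y) => ?;
  do ?split; lra.
Qed.

Lemma diamond_cellE k : @diamond_cell R k = @region R (cell_walls k).
Proof.
apply/seteqP.
suff: forall z, diamond_cell k z <-> @region R (cell_walls k) z.
  by move=> h; split=> z /h.
have c1 : (1 + iC) / 2 = (1 / 2) +i* (1 / 2) by rewrite -half_complex; simpc.
have c2 : (-1 + iC) / 2 = (-1 / 2) +i* (1 / 2) by rewrite -half_complex; simpc.
have c3 : (-1 - iC) / 2 = (-1 / 2) +i* (-1 / 2) by rewrite -half_complex; simpc.
elim/ltn_ind: k => -[|[|[|k]]] IH z; last first.
- rewrite cellS IH; last by rewrite ltnS ltnW.
  rewrite /region /= all_map (eq_all (a2 := fun g => 0 <= ev g (iC * z)))//.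
  by move=> g /=; rewrite ev_rotw.
- rewrite /diamond_cell c1 /mkset disc_ge /region /=.
  split => [[/diamond_setE]|]; case: z => x y /=.
    move=> [k1 k2 k3 k4] h1 /andP[h2 h3].
    (* The redundant circle condition reads [- x (1 + x) + y (1 - y) >= 0], a sum of two nonnegative
       products. *)
    have hx : 0 <= - x * (1 + x) by apply: mulr_ge0; lra.
    have hy : 0 <= y * (1 - y) by apply: mulr_ge0; lra.
    lra.
  move=> h; split; first by apply/diamond_setE; rewrite /=; split; lra.
    lra.
  (* [x > 0] would give [x (1 - x) + y (1 - y) > 0], strictly inside the excluded disc. *)
  have [x0|x0] := leP x 0; first by lra.
  have hx : 0 < x * (1 - x) by apply: mulr_gt0; lra.
  have hy : 0 <= y * (1 - y) by apply: mulr_ge0; lra.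
  lra.
- rewrite /diamond_cell c3 /mkset disc_ge /region /=.
  split => [[/diamond_setE]|]; case: z => x y /=.
    move=> [k1 k2 k3 k4] h1 /andP[h2 h3].
    have hx : 0 <= - x * (1 + x) by apply: mulr_ge0; lra.
    have hy : 0 <= y * (1 - y) by apply: mulr_ge0; lra.
    lra.
  move=> h; split; first by apply/diamond_setE; rewrite /=; split; lra.
    lra.
  have [y0|y0] := leP 0 y; first by lra.
  have hx : 0 <= - x * (1 + x) by apply: mulr_ge0; lra.
  have hy : 0 < - y * (1 + y) by apply: mulr_gt0; lra.
  lra.
- rewrite /diamond_cell c2 c3 /mkset !disc_le /region /=.
  split => [[/diamond_setE]|]; case: z => x y /=.
    move=> [k1 k2 k3 k4] h1 h2.
    (* Both circles pass through 0: the disc conditions bound [x + y] and [x - y] by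
       [- (x^2 + y^2)], which yields the cone. *)
    have := sqr_ge0 x; have := sqr_ge0 y.
    lra.
  by move=> h; split; [apply/diamond_setE; rewrite /=; split|..]; lra.
Qed.

Lemma diamond_set_rot z : diamond_set (iC * z) <-> diamond_set z.
Proof. by rewrite mul_iC /diamond_set /= normrN addrC. Qed.

Lemma diamond_cell_sub k : @diamond_cell R k `<=` @diamond_set R.
Proof.
elim/ltn_ind: k => -[|[|[|k]]] IH z; [by case|by case|by case|].
by move=> /cellS /IH/diamond_set_rot; apply; rewrite ltnS ltnW.
Qed.

(** The quarter is a square whose diagonal is a diameter of the disc [x^2 + y^2 <= x]. In each case
    the two products add up to [x - x^2 - y^2], and the sign of [y] selects the disc. *)
Lemma quarter_discs (x y : R) : - x <= y <= x -> x - 1 <= y <= 1 - x ->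
  (x ^+ 2 + y ^+ 2 - x + y <= 0) || (x ^+ 2 + y ^+ 2 - x - y <= 0).
Proof.
move=> h1 h2; apply/orP; have [y0|y0] := leP 0 y; [right|left].
  have : 0 <= (x - y) * (1 - x) by apply: mulr_ge0; lra.
  have : 0 <= y * (1 - x - y) by apply: mulr_ge0; lra.
  lra.
have : 0 <= (x + y) * (1 - x) by apply: mulr_ge0; lra.
have : 0 <= - y * (1 - x + y) by apply: mulr_ge0; lra.
lra.
Qed.

Definition cells (s : seq nat) : set R[i] :=
  [set z | exists2 k, k \in s & diamond_cell k z].

Lemma cells_sub (s t : seq nat) : {subset s <= t} -> cells s `<=` cells t.
Proof. by move=> st z [k /st kt zk]; exists k. Qed.

(** Two circles cut the quarter according to which discs contain [z]; [quarter_discs] excludes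
    neither, leaving three cells. The other quarters are treated alike. *)
Lemma left_quarter z : diamond_set z ->
  complex.Re z + complex.Im z <= 0 ->
  complex.Re z - complex.Im z <= 0 ->
  cells [:: 0; 11; 1]%N z.
Proof.
move=> /diamond_setE; case: z => x y /= [k1 k2 k3 k4] h1 h2.
have := @quarter_discs (- x) y ltac:(lra) ltac:(lra).
have [h3|h3] := leP (x ^+ 2 + y ^+ 2 + x + y) 0;
have [h4|h4] := leP (x ^+ 2 + y ^+ 2 + x - y) 0 => hq; last by lra.
- by exists 0%N => //; rewrite diamond_cellE /region /=; lra.
- by exists 11%N => //; rewrite diamond_cellE /region /=; lra.
- by exists 1%N => //; rewrite diamond_cellE /region /=; lra.
Qed.

Lemma down_quarter z : diamond_set z ->
  complex.Re z + complex.Im z <= 0 ->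
  0 <= complex.Re z - complex.Im z ->
  cells [:: 9; 8; 10]%N z.
Proof.
move=> /diamond_setE; case: z => x y /= [k1 k2 k3 k4] h1 h2.
have := @quarter_discs (- y) x ltac:(lra) ltac:(lra).
have [h3|h3] := leP (x ^+ 2 + y ^+ 2 + y - x) 0;
have [h4|h4] := leP (x ^+ 2 + y ^+ 2 + y + x) 0 => hq; last by lra.
- by exists 9%N => //; rewrite diamond_cellE /region /=; lra.
- by exists 8%N => //; rewrite diamond_cellE /region /=; lra.
- by exists 10%N => //; rewrite diamond_cellE /region /=; lra.
Qed.

Lemma up_quarter z : diamond_set z ->
  0 <= complex.Re z + complex.Im z ->
  complex.Re z - complex.Im z <= 0 ->
  cells [:: 3; 2; 4]%N z.
Proof.
move=> /diamond_setE; case: z => x y /= [k1 k2 k3 k4] h1 h2.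
have := @quarter_discs y x ltac:(lra) ltac:(lra).
have [h3|h3] := leP (x ^+ 2 + y ^+ 2 - y + x) 0;
have [h4|h4] := leP (x ^+ 2 + y ^+ 2 - y - x) 0 => hq; last by lra.
- by exists 3%N => //; rewrite diamond_cellE /region /=; lra.
- by exists 2%N => //; rewrite diamond_cellE /region /=; lra.
- by exists 4%N => //; rewrite diamond_cellE /region /=; lra.
Qed.

Lemma right_quarter z : diamond_set z ->
  0 <= complex.Re z + complex.Im z ->
  0 <= complex.Re z - complex.Im z ->
  cells [:: 6; 5; 7]%N z.
Proof.
move=> /diamond_setE; case: z => x y /= [k1 k2 k3 k4] h1 h2.
have := @quarter_discs x y ltac:(lra) ltac:(lra).
have [h3|h3] := leP (x ^+ 2 + y ^+ 2 - x - y) 0;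
have [h4|h4] := leP (x ^+ 2 + y ^+ 2 - x + y) 0 => hq; last by lra.
- by exists 6%N => //; rewrite diamond_cellE /region /=; lra.
- by exists 5%N => //; rewrite diamond_cellE /region /=; lra.
- by exists 7%N => //; rewrite diamond_cellE /region /=; lra.
Qed.

Lemma bigcup_cells (s : seq nat) : all (ltn^~ 12%N) s ->
  \bigcup_(j in [set` [set k : 'I_12 | val k \in s]%SET]) diamond_cell j = cells s.
Proof.
move=> /allP s12; apply/seteqP; split=> z [k].
  by rewrite /= inE => ks zk; exists (val k).
by move=> ks zk; exists (Ordinal (s12 k ks)); rewrite //= inE.
Qed.

Lemma diamond_set_cells z : diamond_set z -> cells (iota 0 12) z.
Proof.
move=> zK; have [h1|h1] := leP (complex.Re z + complex.Im z) 0;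
  have [h2|h2] := leP (complex.Re z - complex.Im z) 0.
- by apply: cells_sub (left_quarter zK h1 h2); apply/allP.
- by apply: cells_sub (down_quarter zK h1 (ltW h2)); apply/allP.
- by apply: cells_sub (up_quarter zK (ltW h1) h2); apply/allP.
- by apply: cells_sub (right_quarter zK (ltW h1) (ltW h2)); apply/allP.
Qed.

Lemma bigcup_diamond_cell :
  \bigcup_(j : 'I_12) @diamond_cell R j = @diamond_set R.
Proof.
apply/seteqP; split=> z; first by case=> j _; exact: diamond_cell_sub.
move=> /diamond_set_cells[k]; rewrite mem_iota => k12 zk.
by exists (Ordinal k12).
Qed.

Lemma null_setS A B : A `<=` B -> Defs.null_set B -> Defs.null_set A.
Proof. by move=> AB; apply: negligibleS => p; exact: AB. Qed.

Lemma diamond_cell_partition :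
  finite_partition (@diamond_set R) (fun j : 'I_12 => @diamond_cell R j).
Proof.
split; last exact: bigcup_diamond_cell.
  move=> j; rewrite diamond_cellE; split; first exact: closed_region.
  apply: null_setS (@boundary_region _ _) _.
  exact: null_on_walls (slanted_cell_walls j).
move=> j k /cell_walls_opposite/hasP[g gj gk].
have gs := allP (slanted_cell_walls j) g gj.
rewrite !diamond_cellE; apply/eqP/negP => /negP/set0P.
(* If the interiors met, they would share a point off the common wall, yet the two opposite
   inequalities make [ev g] vanish there. *)
move=> /(open_avoid_wall gs (openI (@open_interior _ _) (@open_interior _ _))).
move=> [z [[/interior_subset/allP/(_ _ gj) h1 /interior_subset/allP/(_ _ gk) h2]]].
move: h1 h2; rewrite /= ev_oppw oppr_ge0 => h1 h2.
by rewrite eq_le h1 h2.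
Qed.
End Cells.

(** * Reduction modulo the Gaussian integers *)

Section Dynamics.
Variable R : realType.
Implicit Types (z w p : R[i]) (A B : set R[i]) (g : wall).
Local Notation iC := (iC R).
Local Notation K := (@diamond_set R).

Definition reduction w := w - diamond w.

Lemma gauss_mapE z : z != 0 -> gauss_map (@diamond R) z = reduction (-1 / z).
Proof. by rewrite /gauss_map => /negbTE ->. Qed.

Lemma reduction_id w : K w -> reduction w = w.
Proof. by move=> wK; rewrite /reduction /diamond mem_set// subr0. Qed.

Lemma reductionE w : ~ K w -> reduction w =
  iter (ex_minn (diamond_step_returns w)) (@diamond_step R) w.
Proof. by move=> wK; rewrite /reduction /diamond memNset// opprB addrC subrK. Qed.

(** The least exponent drops by one, except when [diamond_step w] is already in [K]: exponents are
    positive, so there the convention on [K] takes over. *)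
Lemma reduction_step w : ~ K w -> reduction w = reduction (diamond_step w).
Proof.
move=> wK; rewrite (reductionE wK); case: ex_minnP => -[//|n] /= h nmin.
have [tK|tK] := pselect (K (diamond_step w)).
  have := nmin 1%N; rewrite /= mem_set// => /(_ isT).
  by case: n {nmin} h => // _ _; rewrite reduction_id.
rewrite (reductionE tK); case: ex_minnP => m /andP[m0 mK] mmin.
rewrite -[diamond_step (iter _ _ _)]/(iter n.+1 _ _) iterSr; congr iter.
apply/eqP; rewrite eqn_leq; apply/andP; split.
  by have := nmin m.+1; rewrite iterSr mK => /(_ isT).
apply: mmin; rewrite -iterSr h andbT.
by case: n h {nmin} => //; rewrite /= inE.
Qed.

Definition weak_step w w' (x := complex.Re w) (y := complex.Im w) : Prop :=
  [\/ w' = w - 1 /\ `|y| <= x, w' = w - iC /\ `|x| <= y,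
      w' = w + 1 /\ `|y| <= - x | w' = w + iC /\ `|x| <= - y].

(** Open sectors are disjoint, so this pins down [diamond_step] without computing an argument. *)
Definition strict_step w w' (x := complex.Re w) (y := complex.Im w) : Prop :=
  [\/ w' = w - 1 /\ `|y| < x, w' = w - iC /\ `|x| < y,
      w' = w + 1 /\ `|y| < - x | w' = w + iC /\ `|x| < - y].

Lemma strict_stepE w w' : strict_step w w' -> diamond_step w = w'.
Proof.
have [->|w0] := eqVneq w 0; first by case=> -[_]; rewrite /= ?normr0 ?oppr0 ltxx.
case: (diamond_stepP w0) => -[-> h1] [] [-> h2] //; move: h1 h2.
all: case: w w0 => x y _ /= h1 h2; exfalso; move: h1 h2.
all: by case: (ger0P x) => ?; case: (ger0P y) => ?; lra.
Qed.

Lemma K0 : K 0. Proof. by rewrite /diamond_set /= normr0 addr0 ler01. Qed.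

(* On the sector boundaries [diamond_step] depends on how ties are broken, so
   invariance is required under every choice. *)
Definition stable (A : set R[i]) :=
  forall w w', A w -> ~ K w -> weak_step w w' -> A w'.

(** The induction runs on any exponent leading into [K], not the least one, since the reduction
    stops at the first entry. *)
Lemma stable_reduction A w : stable A -> A w -> A (reduction w) /\ K (reduction w).
Proof.
move=> stA; have [n /andP[_]] := diamond_step_returns w; rewrite inE.
elim: n w => [|n IH] w; first by move=> wK Aw; rewrite reduction_id.
have [wK|wK] := pselect (K w); first by rewrite reduction_id.
rewrite iterSr reduction_step// => nK Aw; apply: IH => //.
apply: (stA _ _ Aw wK); apply: diamond_stepP.
by apply/eqP => w0; apply: wK; rewrite w0; exact: K0.
Qed.

Inductive strict_path : R[i] -> R[i] -> Prop :=
| strict_path_refl w : K w -> strict_path w w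
| strict_path_step w w' p : ~ K w -> strict_step w w' -> strict_path w' p ->
    strict_path w p.

Lemma reduction_strict_path w p : strict_path w p -> reduction w = p.
Proof.
by elim=> [|{}w w' {}p wK /strict_stepE ww' _ <-]; [exact: reduction_id|];
  rewrite reduction_step// ww'.
Qed.

(** * Equivariance under quarter turns *)

Lemma K_rotV w : K (- iC * w) <-> K w.
Proof. by rewrite -[in X in _ <-> X](mul_iCVK w) diamond_set_rot. Qed.

Lemma mul_iCN w : - iC * w = complex.Im w +i* - complex.Re w.
Proof. by case: w => x y; rewrite /Defs.iC; simpc. Qed.

Lemma weak_step_rot w w' : weak_step w w' -> weak_step (- iC * w) (- iC * w').
Proof.
rewrite /weak_step !mul_iCN; case: w => x y /=.
case=> -[-> h]; [apply: Or44|apply: Or41|apply: Or42|apply: Or43];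
  rewrite ?normrN ?opprK; split=> //=; apply/eqP; rewrite eq_complex /=; lra.
Qed.

Lemma strict_step_rot w w' : strict_step w w' -> strict_step (iC * w) (iC * w').
Proof.
rewrite /strict_step !mul_iC; case: w => x y /=.
case=> -[-> h]; [apply: Or42|apply: Or43|apply: Or44|apply: Or41];
  rewrite ?normrN ?opprK; split=> //=; apply/eqP; rewrite eq_complex /=; lra.
Qed.

Lemma strict_path_rot w p : strict_path w p -> strict_path (iC * w) (iC * p).
Proof.
elim=> [{}w wK|{}w w' {}p wK ww' _ pp'].
  by apply: strict_path_refl; apply/diamond_set_rot.
apply: strict_path_step pp'; last exact: strict_step_rot.
by move/diamond_set_rot.
Qed.

(* [cells s] is the image of [K_{j+1}] up to the walls [l]. Invariant sets and
   strict paths stand in for the Gauss map because they rotate by definition,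
   without regard to ties on the sector boundaries. *)
Definition image_spec (j : nat) (s : seq nat) (l : seq wall) : Prop :=
  [/\ exists A, [/\ stable A, forall w, w != 0 -> diamond_cell j (-1 / w) -> A w
        & forall p, K p -> A p -> cells s p],
      forall p, cells s p -> ~ on_walls l p ->
        exists w, [/\ w != 0, diamond_cell j (-1 / w) & strict_path w p]
    & cells s (0 : R[i])].

(** Multiplication by [i] is three turns by [-i], each shifting the index by 3. *)
Definition rot_cell (k : nat) : nat := ((k + 9) %% 12)%N.

Lemma diamond_cell_rot k p : (k < 12)%N ->
  diamond_cell (rot_cell k) p <-> diamond_cell k (- iC * p).
Proof.
move=> k12; have [k3|k3] := ltnP k 3.
  have -> : rot_cell k = (k.+3.+3.+3)%N by case: k k12 k3 => [|[|[|]]].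
  rewrite !cellS; suff -> : iC * (iC * (iC * p)) = - iC * p by [].
  by case: p => x y; rewrite /Defs.iC; simpc.
case: k k12 k3 => [|[|[|k]]]// k12 _.
rewrite cellS mul_iCVK /rot_cell.
have -> : (k.+3 + 9 = k + 12)%N by rewrite (addnC _ 9) (addnC k 12).
by rewrite modnDr modn_small ?(ltnW (ltnW (ltnW k12))).
Qed.

Lemma cells_rot s p : all (ltn^~ 12%N) s ->
  cells (map rot_cell s) p <-> cells s (- iC * p).
Proof.
move=> /allP s12; split => [[_ /mapP[k ks ->] kp]|[k ks kp]].
  by exists k => //; apply/diamond_cell_rot => //; exact: s12.
by exists (rot_cell k); [exact: map_f | apply/diamond_cell_rot => //; exact: s12].
Qed.

Definition rotw3 g := rotw (rotw (rotw g)).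

Lemma on_walls_rot l p : on_walls (map rotw3 l) p <-> on_walls l (- iC * p).
Proof.
rewrite /on_walls /= has_map; suff -> : - iC * p = iC * (iC * (iC * p)).
  by rewrite -(eq_has (a1 := preim rotw3 (fun g => ev g p == 0))) => // g /=;
    rewrite /rotw3 !ev_rotw.
by case: p => x y; rewrite /Defs.iC; simpc.
Qed.

Lemma iC_neq0 : iC != 0.
Proof. by apply/eqP => -[] /eqP; rewrite oner_eq0. Qed.

Lemma inv_rot w : iC * (-1 / w) = -1 / (- iC * w).
Proof.
have iV : (- iC)^-1 = iC.
  have i0 : - iC != 0 by rewrite oppr_eq0 iC_neq0.
  by apply: (mulfI i0); rewrite mulfV// /Defs.iC; simpc.
by rewrite invfM iV mulrCA.
Qed.

(** Turning [z] by [-i] turns [-1 / z] by [i], so the invariant set, the paths and the image turn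
    opposite to the cell. *)
Lemma image_spec_rot j s l : all (ltn^~ 12%N) s ->
  image_spec j s l -> image_spec j.+3 (map rot_cell s) (map rotw3 l).
Proof.
move=> s12 [[A [stA jA As]] sj s0].
split; last by apply/cells_rot => //; rewrite mulr0.
  exists [set w | A (- iC * w)]; split=> [w w' /= Aw wK ww'|w w0 /cellS|p pK Ap].
  - apply: stA Aw _ (weak_step_rot ww').
    by move/K_rotV.
  - by rewrite inv_rot; apply: jA; rewrite mulf_neq0 ?oppr_eq0 ?iC_neq0.
  - by apply/cells_rot => //; apply: As => //; apply/K_rotV.
move=> p /(cells_rot _ s12)/sj h /on_walls_rot/h[w [w0 wj wp]].
exists (iC * w); split; first by rewrite mulf_neq0 ?iC_neq0.
  by apply/cellS; rewrite inv_rot mul_iCK.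
by rewrite -(mul_iCVK p); apply: strict_path_rot.
Qed.

Lemma neg_invK : involutive (fun z : R[i] => -1 / z).
Proof. by move=> z; rewrite !mulN1r invrN opprK invrK. Qed.

Lemma neg_inv_neq0 z : z != 0 -> -1 / z != 0.
Proof. by rewrite mulN1r oppr_eq0 invr_eq0. Qed.

(** The invariant set puts the whole image inside [cells s]; the strict paths reach every point of
    [cells s] off the null set of walls. *)
Lemma image_spec_buildable j s l : all (ltn^~ 12%N) s -> all slanted l ->
  image_spec j s l ->
  buildable (fun k : 'I_12 => @diamond_cell R k)
    (gauss_map (@diamond R) @` @diamond_cell R j).
Proof.
move=> s12 ls [[A [stA jA As]] sj s0].
exists [set k : 'I_12 | val k \in s]%SET; rewrite bigcup_cells//.
apply: null_setS (null_on_walls _ ls) => p [[[z zj <-] np]|[sp np]].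
  exfalso; apply: np.
  (* The Gauss map sends 0 to 0 by convention, hence the clause of [image_spec] about 0. *)
  have [->|z0] := eqVneq z 0; first by rewrite /gauss_map eqxx.
  rewrite gauss_mapE//.
  have zw : A (-1 / z) by apply: jA; [exact: neg_inv_neq0 | rewrite neg_invK].
  by have [? ?] := stable_reduction stA zw; exact: As.
apply: contra_notP np => /(sj _ sp) [w [w0 wj /reduction_strict_path <-]].
by exists (-1 / w) => //; rewrite gauss_mapE ?neg_inv_neq0// neg_invK.
Qed.

End Dynamics.

(** * Images of the cells *)

(** The two diagonals and the four sides of [K]; the last wall is the side [x - y = 1], which bounds
    neither cone. *)
Definition generic_walls : seq wall := left_cone ++ up_cone ++ [:: (0, -1, 1, 1)].

Section Images.
Variable R : realType.
Implicit Types (z w p : R[i]) (g : wall).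
Local Notation iC := (iC R).
Local Notation K := (@diamond_set R).
Local Arguments diamond_cell : simpl never.

Lemma ev_neg_inv g w : w != 0 ->
  (0 <= ev g (-1 / w)) = (0 <= ev (invw g) w).
Proof.
move=> w0; set s := complex.Re w ^+ 2 + complex.Im w ^+ 2.
have s0 : 0 < s.
  rewrite lt0r addr_ge0 ?sqr_ge0// andbT; apply: contra w0.
  rewrite paddr_eq0 ?sqr_ge0// !sqrf_eq0 => /andP[/eqP h1 /eqP h2].
  by rewrite eq_complex h1 h2 !eqxx.
have : (-1 / w) * w = -1 by rewrite divfK.
rewrite -(pmulr_rge0 (ev g _) s0); case: (-1 / w) => x y.
case: w w0 @s s0 => u v _ s s0; simpc => -[h1 h2].
congr (0 <= _).
(* With [z = -1 / w], the next three identities say [z |w|^2 = - conj w] and [|z|^2 |w|^2 = 1]; all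
   follow from [z w = -1]. *)
have hx : x * s = - u.
  apply/eqP; rewrite -subr_eq0 /s /=.
  rewrite (_ : _ - _ = (x * u - y * v + 1) * u + (x * v + y * u) * v); last by ring.
  by rewrite h1 h2; apply/eqP; ring.
have hy : y * s = v.
  apply/eqP; rewrite -subr_eq0 /s /=.
  rewrite (_ : _ - _ = - (x * u - y * v + 1) * v + (x * v + y * u) * u); last by ring.
  by rewrite h1 h2; apply/eqP; ring.
have hs : (x ^+ 2 + y ^+ 2) * s = 1.
  rewrite /s /= (_ : _ * _ = (x * u - y * v) ^+ 2 + (x * v + y * u) ^+ 2); last by ring.
  by rewrite h1 h2; ring.
case: g => [[[q a] b] c]; rewrite /ev /= rmorphN /=.
have -> : s * (q%:~R * (x ^+ 2 + y ^+ 2) + a%:~R * x + b%:~R * y + c%:~R) =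
  q%:~R * ((x ^+ 2 + y ^+ 2) * s) + a%:~R * (x * s) + b%:~R * (y * s) + c%:~R * s by ring.
by rewrite hx hy hs /s /=; ring.
Qed.

Lemma cell_neg_inv k w : w != 0 ->
  diamond_cell k (-1 / w) <-> region (map invw (cell_walls k)) w.
Proof.
move=> w0; rewrite diamond_cellE /region /= all_map.
by rewrite (eq_all (a2 := preim invw (fun g => 0 <= ev g w)))// => g /=;
  rewrite ev_neg_inv.
Qed.

Lemma not_diamondE w : ~ K w -> 1 < `|complex.Re w| + `|complex.Im w|.
Proof. by move/negP; rewrite -ltNge. Qed.

Lemma generic_diamond p : K p -> ~ on_walls generic_walls p ->
  [/\ complex.Re p + complex.Im p != 0, complex.Re p - complex.Im p != 0,
      -1 < complex.Re p + complex.Im p < 1 & -1 < complex.Re p - complex.Im p < 1].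
Proof.
move=> /diamond_setE; case: p => x y /= [k1 k2 k3 k4] /negP.
rewrite /= !negb_or => h.
have n1 : x + y != 0 by apply: contraTneq h => e; rewrite !negb_and !negbK; lra.
have n2 : x - y != 0 by apply: contraTneq h => e; rewrite !negb_and !negbK; lra.
have n3 : x + y != 1 by apply: contraTneq h => e; rewrite !negb_and !negbK; lra.
have n4 : x - y != 1 by apply: contraTneq h => e; rewrite !negb_and !negbK; lra.
have n5 : - x + y != 1 by apply: contraTneq h => e; rewrite !negb_and !negbK; lra.
have n6 : - x - y != 1 by apply: contraTneq h => e; rewrite !negb_and !negbK; lra.
split=> //; have lt (a : R) : a != 1 -> a <= 1 -> a < 1.
  1,3: by move=> ? ?; rewrite lt_neqAle; apply/andP.
all: by move: (lt _ n3 k1) (lt _ n4 k2) (lt _ n5 k3) (lt _ n6 k4); lra.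
Qed.

Lemma complex_neq0 (x y : R) : 0 < x -> x +i* y != 0.
Proof. by move=> x0; rewrite eq_complex /= gt_eqF. Qed.

Lemma strict_path_preimage j (x y : R) p : 0 < x ->
  region (map invw (cell_walls j)) (x +i* y) -> strict_path (x +i* y) p ->
  exists w, [/\ w != 0, diamond_cell j (-1 / w) & strict_path w p].
Proof.
move=> /(complex_neq0 y) w0 jw wp; exists (x +i* y); split=> //.
exact/(cell_neg_inv _ w0).
Qed.

Lemma strict_path_right (x y x' : R) p : - x < y < x -> 1 < x + y \/ 1 < x - y ->
  x' = x - 1 -> strict_path (x' +i* y) p -> strict_path (x +i* y) p.
Proof.
move=> h1 h2 ->; apply: strict_path_step.
  by rewrite /diamond_set /=; case: (ger0P x) => ?; case: (ger0P y) => ?;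
    case: h2; lra.
by apply: Or41; rewrite ltr_norml h1; split=> //; simpc.
Qed.

Lemma strict_path_up (x y y' : R) p : - y < x < y -> 1 < x + y ->
  y' = y - 1 -> strict_path (x +i* y') p -> strict_path (x +i* y) p.
Proof.
move=> h1 h2 ->; apply: strict_path_step.
  by rewrite /diamond_set /=; case: (ger0P x) => ?; case: (ger0P y) => ?; lra.
by apply: Or42; rewrite ltr_norml h1; split=> //; simpc.
Qed.

Lemma image_spec0 : image_spec R 0 (iota 2 9) generic_walls.
Proof.
split; last by exists 2%N => //; rewrite diamond_cellE /region /=; lra.
(* [-1 / K_1] is the cone [|y| <= x - 1]. The invariant set is its translate with apex [-1], minus
   the open left quarter of [K]. *)
- exists [set w | (0 <= complex.Re w + complex.Im w \/
      0 <= complex.Re w - complex.Im w) /\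
    - complex.Re w - 1 <= complex.Im w <= complex.Re w + 1].
  split.
  + move=> w w' [h1 h2] /not_diamondE; case: w h1 h2 => x y /= h1 h2 h3.
    by case=> -[-> /=] h4; move: h3 h4; case: (ger0P x) => ?;
      case: (ger0P y) => ? h3 h4; split; last lra; case: h1 => h1;
      solve [lra | left; lra | right; lra].
  + move=> w w0 /(cell_neg_inv _ w0); case: w w0 => x y _; rewrite /region /= => h.
    by split; [left|]; lra.
  + move=> p pK [[h|h] _].
      have [h'|h'] := leP (complex.Re p - complex.Im p) 0.
        by apply: cells_sub (up_quarter pK h h'); apply/allP.
      by apply: cells_sub (right_quarter pK h (ltW h')); apply/allP.
    have [h'|h'] := leP (complex.Re p + complex.Im p) 0.
      by apply: cells_sub (down_quarter pK h' h); apply/allP.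
    by apply: cells_sub (right_quarter pK (ltW h') h); apply/allP.
- move=> p sp gp.
  have pK : K p by case: sp => k _; exact: diamond_cell_sub.
  have [] := generic_diamond pK gp.
  have {sp gp} : 0 <= complex.Re p + complex.Im p \/
      0 <= complex.Re p - complex.Im p.
    case: sp => k; rewrite diamond_cellE; case: p {gp pK} => x y /=.
    by rewrite !inE => /or4P[|||/or4P[|||/or3P[]]] /eqP ->; rewrite /region /= => h;
      ((left; lra) || (right; lra)).
  case: p pK => a b /= pK hp n1 n2 k1 k2.
  have [h1|h1|h1] := ltgtP 0 (a + b); last by rewrite -h1 eqxx in n1.
    have [h2|h2|h2] := ltgtP 0 (a - b); last by rewrite -h2 eqxx in n2.
      (* In the right quarter [p + 1] already lies in the cone [|y| <= x - 1]; in the upper and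
         lower quarters [p + 2] is taken instead. *)
      apply: (strict_path_preimage (x := a + 1) (y := b)); first lra.
        by have := sqr_ge0 a; have := sqr_ge0 b; rewrite /region /=; lra.
      apply: (strict_path_right (x' := a)); [lra|left; lra|lra|].
      exact: strict_path_refl.
    apply: (strict_path_preimage (x := a + 2) (y := b)); first lra.
      by have := sqr_ge0 a; have := sqr_ge0 b; rewrite /region /=; lra.
    apply: (strict_path_right (x' := a + 1)); [lra|left; lra|lra|].
    apply: (strict_path_right (x' := a)); [lra|left; lra|lra|].
    exact: strict_path_refl.
  have [h2|h2|h2] := ltgtP 0 (a - b); last by rewrite -h2 eqxx in n2.
    apply: (strict_path_preimage (x := a + 2) (y := b)); first lra.
      by have := sqr_ge0 a; have := sqr_ge0 b; rewrite /region /=; lra.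
    apply: (strict_path_right (x' := a + 1)); [lra|right; lra|lra|].
    apply: (strict_path_right (x' := a)); [lra|right; lra|lra|].
    exact: strict_path_refl.
  by exfalso; case: hp; lra.
Qed.

(* [G(K_2)] and [G(K_3)] agree up to measure zero: both [-1 / K_2] and
   [-1 / K_3] lie in this strip. *)
Definition strip : set R[i] := [set w |
  0 <= complex.Re w + complex.Im w /\ -1 <= complex.Re w - complex.Im w <= 1].

(** Outside [K] the strip has [x + y > 1], so the step subtracts [1] (only if [x >= y]) or [i] (only
    if [x <= y]): [x + y] stays nonnegative and [x - y] stays in [[-1, 1]]. *)
Lemma stable_strip : stable strip.
Proof.
move=> w w' [h1 h2] /not_diamondE; case: w h1 h2 => x y /= h1 h2 h3.
by case=> -[-> /=] h4; move: h3 h4; case: (ger0P x) => ?;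
  case: (ger0P y) => ? h3 h4; rewrite /strip /=; split; lra.
Qed.

Lemma half_diamond_cells p : K p -> 0 <= complex.Re p + complex.Im p ->
  cells (iota 2 6) p.
Proof.
move=> pK h; have [h'|h'] := leP (complex.Re p - complex.Im p) 0.
  by apply: cells_sub (up_quarter pK h h'); apply/allP.
by apply: cells_sub (right_quarter pK h (ltW h')); apply/allP.
Qed.

Lemma cells_half_diamond p : cells (iota 2 6) p ->
  K p /\ 0 <= complex.Re p + complex.Im p.
Proof.
move=> [k ks pk]; split; first exact: diamond_cell_sub pk.
move: ks pk; rewrite diamond_cellE; case: p => x y /=.
by rewrite !inE => /or4P[|||/or3P[]] /eqP ->; rewrite /region /=; lra.
Qed.

Lemma image_spec1 : image_spec R 1 (iota 2 6) generic_walls.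
Proof.
split; last by exists 2%N => //; rewrite diamond_cellE /region /=; lra.
- exists strip; split; first exact: stable_strip;
    last by move=> p pK [? _]; exact: half_diamond_cells.
  move=> w w0 /(cell_neg_inv _ w0); case: w w0 => x y _; rewrite /region /= => h.
  by rewrite /strip /=; split; lra.
- move=> p /cells_half_diamond[pK hp] gp.
  have [] := generic_diamond pK gp; case: p pK hp {gp} => a b /= pK hp n1 n2 k1 k2.
  have h1 : 0 < a + b by rewrite lt0r n1.
  have [h2|h2|h2] := ltgtP 0 (a - b); last by rewrite -h2 eqxx in n2.
    (* [-1 / K_2] occupies the half [0 <= x - y <= 1] of the strip. The shift [1 + i] preserves
       [x - y] and clears the discs; for [a < b] the shift [2 + i] raises [x - y] by 1. *)
    apply: (strict_path_preimage (x := a + 1) (y := b + 1)); first lra.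
      by have := sqr_ge0 a; have := sqr_ge0 b; rewrite /region /=; lra.
    apply: (strict_path_right (x' := a)); [lra|left; lra|lra|].
    apply: (strict_path_up (y' := b)); [lra|lra|lra|].
    exact: strict_path_refl.
  apply: (strict_path_preimage (x := a + 2) (y := b + 1)); first lra.
    by have := sqr_ge0 a; have := sqr_ge0 b; rewrite /region /=; lra.
  apply: (strict_path_right (x' := a + 1)); [lra|left; lra|lra|].
  apply: (strict_path_up (y' := b)); [lra|lra|lra|].
  apply: (strict_path_right (x' := a)); [lra|left; lra|lra|].
  exact: strict_path_refl.
Qed.

Lemma image_spec2 : image_spec R 2 (iota 2 6) generic_walls.
Proof.
split; last by exists 2%N => //; rewrite diamond_cellE /region /=; lra.
- exists strip; split; first exact: stable_strip;
    last by move=> p pK [? _]; exact: half_diamond_cells.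
  move=> w w0 /(cell_neg_inv _ w0); case: w w0 => x y _; rewrite /region /= => h.
  by rewrite /strip /=; split; lra.
- move=> p /cells_half_diamond[pK hp] gp.
  have [] := generic_diamond pK gp; case: p pK hp {gp} => a b /= pK hp n1 n2 k1 k2.
  have h1 : 0 < a + b by rewrite lt0r n1.
  have [h2|h2|h2] := ltgtP 0 (a - b); last by rewrite -h2 eqxx in n2.
    (* Here the half is [-1 <= x - y <= 0], so for [a > b] the shift [1 + 2 i] lowers [x - y] by
       1. *)
    apply: (strict_path_preimage (x := a + 1) (y := b + 2)); first lra.
      by have := sqr_ge0 a; have := sqr_ge0 b; rewrite /region /=; lra.
    apply: (strict_path_up (y' := b + 1)); [lra|lra|lra|].
    apply: (strict_path_right (x' := a)); [lra|left; lra|lra|].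
    apply: (strict_path_up (y' := b)); [lra|lra|lra|].
    exact: strict_path_refl.
  apply: (strict_path_preimage (x := a + 1) (y := b + 1)); first lra.
    by have := sqr_ge0 a; have := sqr_ge0 b; rewrite /region /=; lra.
  apply: (strict_path_up (y' := b)); [lra|lra|lra|].
  apply: (strict_path_right (x' := a)); [lra|left; lra|lra|].
  exact: strict_path_refl.
Qed.

Lemma diamond_image_spec (j : nat) : exists s l,
  [/\ image_spec R j s l, all (ltn^~ 12%N) s & all slanted l].
Proof.
(* A quarter turn swaps the coefficients of [Re] and [Im] up to sign, so the induction keeps both
   nonzero. *)
suff [s [l [jsl s12 l2]]] : exists s l, [/\ image_spec R j s l,
    all (ltn^~ 12%N) s & all (fun g => slanted g && slanted (rotw g)) l].
  by exists s, l; split=> //; apply: sub_all l2 => g /andP[].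
elim/ltn_ind: j => -[|[|[|j]]] IH.
- by exists (iota 2 9), generic_walls; split=> //; exact: image_spec0.
- by exists (iota 2 6), generic_walls; split=> //; exact: image_spec1.
- by exists (iota 2 6), generic_walls; split=> //; exact: image_spec2.
have [|s [l [jsl s12 l2]]] := IH j; first by rewrite ltnS ltnW.
exists (map rot_cell s), (map rotw3 l); split; first exact: image_spec_rot.
  by rewrite all_map; apply/allP => k _; rewrite /= ltn_pmod.
rewrite all_map; apply: sub_all l2 => -[[[q a] b] c] /=.
by rewrite !oppr_eq0 andbC.
Qed.

End Images.

Theorem proposition4p7 (R : realType) :
  finite_building (@diamond R) (@diamond_set R)
    (fun j : 'I_12 => @diamond_cell R j).
Proof.
split=> //; first exact: diamond_cell_partition.
move=> j; have [s [l [jsl s12 ls]]] := diamond_image_spec R j.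
exact: image_spec_buildable jsl.
Qed.
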